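(* Let $0<y<\frac12$. Then $|L(y)|=2$ if and only if $$\Phi(\Psi^n(y))>\frac23\qquad\text{for all } n\ge0.$$
   Context: Let $\phi(x)=\operatorname{dist}(x,\mathbb{Z})$; the Takagi function is $T(x)=\sum_{n=0}^\infty 2^{-n}\phi(2^nx)$, and $L(y)=\{x\in[0,1]:T(x)=y\}$. $|\cdot|$ denotes cardinality. Let $t_k=k/2^k$ for $k\in\mathbb{N}$, $I_2=[\frac12,\frac23]$, and $I_k=[t_k,t_{k-1})$ for $k\ge3$. Thus $[0,\frac23]$ is the disjoint union of $\{0\}$ and the $I_k$, $k\ge 2$. Define $\Psi:[0,\frac23]\to[0,\frac23]$ by $\Psi(0)=0$ and $\Psi(y)=4(y-t_k)$ if $y\in I_k$ ($k\ge 2$). $\Psi^n$ is the $n$-fold iterate, $\Psi^0(y)=y$. Define $\Phi:[0,\infty)\to[0,\infty)$ by $\Phi(0)=0$; $\Phi(y)=4^k(y-t_k)$ if $y\in I_k$ with $k\ge3$; $\Phi(y)=4(y-\frac12)$ if $y\ge\frac12$. *)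

(* Defs.v *)
From mathcomp Require Import all_boot all_order all_algebra.
From mathcomp Require Import all_classical all_reals all_analysis.
Set Implicit Arguments.
Unset Strict Implicit.
Unset Printing Implicit Defensive.
Import Order.TTheory GRing.Theory Num.Theory.
Import numFieldNormedType.Exports.
Local Open Scope classical_set_scope.
Local Open Scope ring_scope.

Definition dist_int {R : realType} (x : R) : R :=
  inf [set `|x - m%:~R| | m in [set: int]].

Definition takagi {R : realType} (x : R) : R :=
  limn (series (fun n : nat => 2 ^- n * dist_int (2 ^+ n * x))).

Definition level_set {R : realType} (y : R) : set R :=
  [set x | 0 <= x <= 1 /\ takagi x = y].

Definition tk (R : realType) (k : nat) : R := k%:R / 2 ^+ k.

(* Only meaningful for k >= 2; the right endpoint 2/3 is included for k = 2. *)
Definition Iset {R : realType} (k : nat) : set R :=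
  if k == 2%N then `[1 / 2, 2 / 3]%classic else `[tk R k, tk R k.-1[%classic.

(* The unique k >= 2 with y in I_k when 0 < y <= 2/3; otherwise the junk
   value 0. *)
Definition Iindex {R : realType} (y : R) : nat :=
  xget 0%N [set k | (2 <= k)%N /\ Iset k y].

(* A self-map of [0, 2/3]; the values outside this interval are junk. *)
Definition Psi {R : realType} (y : R) : R :=
  if y == 0 then 0 else 4 * (y - tk R (Iindex y)).

(* A self-map of [0, +oo[; the values at negative reals are junk. *)
Definition Phi {R : realType} (y : R) : R :=
  if y == 0 then 0
  else if 1 / 2 <= y then 4 * (y - 1 / 2)
  else 4 ^+ Iindex y * (y - tk R (Iindex y)).

(* Main.v *)
(** The Takagi function [T] satisfies [T x = x + T (2 x) / 2] on [[0, 1/2]] and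
    [T (1 - x) = T x], so the claim is that [T x = y] has a unique solution in
    [[0, 1/2)].  Let [y] lie in [I_k].  On [[2^-k, 2^-(k-1)]] the graph of [T]
    contains the copy [T (2^-k + x/4) = t_k + T x / 4] of its part above
    [[0, 2^-(k-2)]]; this turns the solutions for [y] in that interval into the
    solutions for [Psi y] in [[0, 1/2)], scaled by [1/4].  To the right of
    [2^-(k-1)] one has [T >= t_(k-1) > y], and on [[0, 2^-k]] the sharp maximum
    of [T] is [t_k + 4^-k * 2/3], so a solution below [2^-k] exists if and only
    if [Phi y <= 2/3].  Hence uniqueness at [y] amounts to [Phi y > 2/3] and
    uniqueness at [Psi y]; conversely, when the condition holds along the whole
    orbit, two solutions have distance at most [4^-n] for every [n]. *)
Require Import Defs.
From mathcomp Require Import all_boot all_order all_algebra.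
From mathcomp Require Import all_classical all_reals all_analysis.
From mathcomp Require Import ring lra.
Import Order.TTheory GRing.Theory Num.Theory.
Import numFieldNormedType.Exports.
Local Open Scope classical_set_scope.
Local Open Scope ring_scope.

(** * The distance to the nearest integer *)

Lemma dist_int_le {R : realType} (x : R) (m : int) :
  dist_int x <= `|x - m%:~R|.
Proof.
apply: ge_inf; last by exists m.
by exists 0 => _ [k _ <-]; exact: normr_ge0.
Qed.

Lemma le_dist_int {R : realType} (c x : R) :
  (forall m : int, c <= `|x - m%:~R|) -> c <= dist_int x.
Proof.
move=> h; apply: lb_le_inf; first by exists `|x - 0%:~R|, 0.
by move=> _ [m _ <-].
Qed.

Lemma dist_int_ge0 {R : realType} (x : R) : 0 <= dist_int x.
Proof. by apply: le_dist_int => m; exact: normr_ge0. Qed.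

Lemma dist_int_le1 {R : realType} (x : R) : dist_int x <= 1.
Proof.
apply: le_trans (dist_int_le x (Num.floor x)) _.
have /andP[] := floor_itv x; rewrite intrD ler_norml; lra.
Qed.

Lemma dist_int_lipschitz {R : realType} (x y : R) :
  `|dist_int x - dist_int y| <= `|x - y|.
Proof.
have aux (a b : R) : dist_int a - dist_int b <= `|a - b|.
  rewrite lerBlDr -lerBlDl; apply: le_dist_int => m.
  rewrite lerBlDl; apply: le_trans (dist_int_le a m) _.
  by rewrite -(subrKA b); exact: ler_normD.
by rewrite ler_norml lerNl opprB aux distrC aux.
Qed.

Lemma dist_int_id {R : realType} (x : R) :
  0 <= x <= 1 / 2 -> dist_int x = x.
Proof.
move=> /andP[x0 x1]; apply/le_anti/andP; split.
  by apply: le_trans (dist_int_le x 0) _; rewrite subr0 ger0_norm.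
apply: le_dist_int => m; have [m1|m0] := leP 1 m.
  have : (1 : R) <= m%:~R by rewrite ler1z.
  by move=> ?; rewrite distrC ger0_norm; lra.
have : (m%:~R : R) <= 0 by rewrite lerz0 -ltzD1.
by move=> ?; rewrite ger0_norm; lra.
Qed.

Lemma dist_int_subz {R : realType} (m : int) (x : R) :
  dist_int (m%:~R - x) = dist_int x.
Proof.
have aux (y : R) : dist_int (m%:~R - y) <= dist_int y.
  apply: le_dist_int => k; apply: le_trans (dist_int_le _ (m - k)) _.
  by rewrite intrB (_ : _ - _ = - (y - k%:~R)) ?normrN//; lra.
by apply/le_anti; rewrite aux -{1}(subKr m%:~R x) aux.
Qed.

(** * Functional equations and continuity of the Takagi function *)

Section Takagi.
Context {R : realType}.
Implicit Types (x y z v w : R) (k n : nat).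

Let term x n : R := 2 ^- n * dist_int (2 ^+ n * x).

Let term_ge0 x n : 0 <= term x n.
Proof. by rewrite mulr_ge0 ?dist_int_ge0// invr_ge0 exprn_ge0. Qed.

Let term_le x n : term x n <= geometric 1 (2^-1) n.
Proof.
by rewrite /term /= mul1r exprVn ler_piMr ?dist_int_le1// invr_ge0 exprn_ge0.
Qed.

Let half_lt1 : `|2^-1 : R| < 1.
Proof. by rewrite ger0_norm; lra. Qed.

Let is_cvg_takagi x : cvgn (series (term x)).
Proof.
apply: (series_le_cvg (term_ge0 x) _ (term_le x)).
  by move=> n; rewrite geometric_ge0// invr_ge0.
exact: is_cvg_geometric_series half_lt1.
Qed.

Lemma takagi_ge0 x : 0 <= takagi x.
Proof.
apply: limr_ge; first exact: is_cvg_takagi.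
by near=> n; apply: sumr_ge0 => i _; exact: term_ge0.
Unshelve. all: by end_near. Qed.

Lemma takagi_le2 x : takagi x <= 2.
Proof.
apply: le_trans (lim_series_le (is_cvg_takagi x) _ (term_le x)) _.
  exact: is_cvg_geometric_series half_lt1.
rewrite (cvg_lim _ (@cvg_geometric_series _ 1 _ half_lt1))//.
by rewrite mul1r (_ : 1 - 2^-1 = 2^-1) ?invrK//; lra.
Qed.

Lemma takagiE x : takagi x = dist_int x + takagi (2 * x) / 2.
Proof.
apply: cvg_lim => //.
rewrite -cvg_shiftS.
have E n : series (term x) n.+1 = dist_int x + series (term (2 * x)) n / 2.
  rewrite /series /= big_nat_recl//= /term expr0 invr1 !mul1r mulr_suml.
  congr (_ + _); apply: eq_bigr => i _.
  rewrite mulrA -exprSr mulrAC; congr (_ * _).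
  by rewrite exprS invfM mulrC.
rewrite (_ : (fun n => _) = (fun n => dist_int x + series (term (2 * x)) n / 2)).
  by apply: cvgD; [exact: cvg_cst|apply: cvgMr_tmp; exact: is_cvg_takagi].
exact/funext.
Qed.

Lemma takagi_sym x : takagi (1 - x) = takagi x.
Proof.
suff E : term (1 - x) = term x.
  by rewrite /takagi; move: E; rewrite /term => ->.
apply/funext => n; congr (_ * _); rewrite mulrBr mulr1.
(* The power is recast as an integer so that [dist_int_subz] applies. *)
have -> : 2 ^+ n = (2 ^ n)%:Z%:~R :> R by rewrite -(natrX R 2 n).
exact: dist_int_subz.
Qed.

Lemma takagi_half x : 0 <= x <= 1 / 2 -> takagi x = x + takagi (2 * x) / 2.
Proof. by move=> hx; rewrite takagiE dist_int_id. Qed.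

Lemma takagi0 : takagi (0 : R) = 0.
Proof. by have := @takagi_half 0; rewrite mulr0; lra. Qed.

(** As [1 - 1/3 = 2 * (1/3)], symmetry and the functional equation give one linear equation for the
    value. *)
Lemma takagi13 : takagi (1 / 3 : R) = 2 / 3.
Proof.
have := @takagi_half (1 / 3); have := takagi_sym (1 / 3).
by rewrite (_ : 1 - 1 / 3 = 2 * (1 / 3)); lra.
Qed.

Lemma pow4VE n : 4 ^- n = 2 ^- n * 2 ^- n :> R.
Proof. by rewrite (_ : 4 = 2 * 2) ?exprMn ?invfM//; lra. Qed.

(* Iterating [T x = dist_int x + T (2 x) / 2] twice; the exponent 1/2 is far from
   optimal, but it suffices for continuity. *)
Lemma takagi_dist x y n :
  `|x - y| <= 4 ^- n -> `|takagi x - takagi y| <= 4 * 2 ^- n.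
Proof.
elim: n x y => [|n IH] x y hxy.
  rewrite expr0 invr1 mulr1 ler_norml.
  by move: (takagi_ge0 x) (takagi_ge0 y) (takagi_le2 x) (takagi_le2 y); lra.
have e4 : 4 ^- n.+1 = 4 ^- n / 4 :> R by rewrite exprSr invfM mulrC.
have e2 : 2 ^- n.+1 = 2 ^- n / 2 :> R by rewrite exprSr invfM mulrC.
have p2 : 0 <= (2 ^- n : R) <= 1.
  by apply/andP; split; rewrite -exprVn ?exprn_ge0 ?exprn_ile1//; lra.
have /IH : `|4 * x - 4 * y| <= 4 ^- n.
  by rewrite -mulrBr normrM ger0_norm// -ler_pdivlMl// mulrC -e4.
have d1 := dist_int_lipschitz x y.
have d2 : `|dist_int (2 * x) - dist_int (2 * y)| <= 2 * `|x - y|.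
  by apply: le_trans (dist_int_lipschitz _ _) _; rewrite -mulrBr normrM ger0_norm.
have E z : takagi z = dist_int z + (dist_int (2 * z) + takagi (4 * z) / 2) / 2.
  by rewrite takagiE (takagiE (2 * z)) (_ : 2 * (2 * z) = 4 * z)//; lra.
have {}hxy : `|x - y| <= 2 ^- n * 2 ^- n / 4 by rewrite -pow4VE -e4.
have pp : 2 ^- n * 2 ^- n <= 2 ^- n :> R by case/andP: p2 => *; rewrite ler_piMr.
rewrite (E x) (E y) e2; move: p2 pp hxy d1 d2.
move: (2 ^- n) `|x - y| => p z.
move: (dist_int x) (dist_int y) (dist_int (2 * x)) (dist_int (2 * y)).
move: (takagi (4 * x)) (takagi (4 * y)) => a b c d e f.
by rewrite !ler_norml; lra.
Qed.

Lemma continuous_takagi : continuous (@takagi R).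
Proof.
move=> x; apply/cvgrPdist_le => e e0.
have [n hn] : exists n, 4 / e < 2 ^+ n.
  by exists (Num.Def.archi_bound (4 / e)); apply: upper_nthrootP.
have p4 : 0 < 4 ^- n :> R by rewrite invr_gt0 exprn_gt0.
have he : 4 * 2 ^- n <= e.
  rewrite ler_pdivrMr ?exprn_gt0// mulrC -ler_pdivrMr//; exact: ltW.
have h := (cvgrPdist_le id x).1 (@cvg_id _ (nbhs x)) _ p4.
near=> y; apply: le_trans he; apply: takagi_dist; near: y; exact: h.
Unshelve. all: by end_near. Qed.

(** Intermediate values between [0] and [1/3]; the bound [1/3] keeps the solution inside
    [[0, 1/2)]. *)
Lemma takagi_surj y : 0 <= y <= 2 / 3 -> exists2 x, 0 <= x <= 1 / 3 & takagi x = y.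
Proof.
move=> hy.
have [|||x hx <-] := @IVT R takagi 0 (1 / 3) y.
- lra.
- exact: continuous_subspaceT continuous_takagi.
- by rewrite takagi0 takagi13 min_l ?max_r; lra.
by exists x => //; move: hx; rewrite in_itv.
Qed.

End Takagi.

(** * Self-similar copies in the graph and the bounds they give *)

Section SelfSimilarity.
Context {R : realType}.
Implicit Types (x y u v w : R) (j k n c : nat).

Lemma pow2VS k : 2 ^- k.+1 = 2 ^- k / 2 :> R.
Proof. by rewrite exprSr invfM mulrC. Qed.

Lemma pow2V_gt0 k : 0 < 2 ^- k :> R.
Proof. by rewrite invr_gt0 exprn_gt0. Qed.

Lemma pow2V_le1 k : 2 ^- k <= 1 :> R.
Proof. by rewrite -exprVn exprn_ile1//; lra. Qed.

Lemma pow2V_anti j k : (j <= k)%N -> 2 ^- k <= 2 ^- j :> R.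
Proof. by move=> jk; rewrite lef_pV2 ?posrE ?exprn_gt0// ler_eXn2l// ltr1n. Qed.

Lemma tkE k : tk R k = k%:R * 2 ^- k.
Proof. by []. Qed.

Lemma tkS k : tk R k.+1 = tk R k / 2 + 2 ^- k.+1.
Proof. by rewrite !tkE pow2VS -natr1; lra. Qed.

Lemma tk1 : tk R 1 = 1 / 2.
Proof. by rewrite tkE expr1; lra. Qed.

Lemma tk2 : tk R 2 = 1 / 2.
Proof. by rewrite tkS tk1 pow2VS expr1; lra. Qed.

(** Index [0] is left out because [tk R 0 = 0] lies below [tk R 1]. *)
Lemma tk_anti : {in [pred k | (0 < k)%N] &,
  {homo tk R : j k / (j <= k)%N >-> k <= j}}.
Proof.
move=> j k; rewrite !inE => j0 _ /subnK <-; elim: (k - j)%N => // n IH.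
apply: le_trans IH; rewrite addSn tkS tkE pow2VS.
have : 1 <= (n + j)%:R :> R by rewrite ler1n addn_gt0 j0 orbT.
by have := pow2V_gt0 (n + j); nra.
Qed.

(** Each halving of the argument halves the value and adds the new argument, whence the term linear
    in [k]. *)
Lemma takagi_scale k u : 0 <= u <= 1 ->
  takagi (2 ^- k * u) = 2 ^- k * (takagi u + k%:R * u).
Proof.
move=> hu; elim: k => [|k IH]; first by rewrite expr0 invr1 !mul1r mul0r addr0.
have := pow2V_gt0 k; have := pow2V_le1 k => p1 p0.
rewrite takagi_half pow2VS; last by nra.
rewrite (_ : 2 * _ = 2 ^- k * u); last by lra.
by rewrite IH -natr1; lra.
Qed.

Lemma takagi_left_quarter v : 0 <= v <= 1 -> takagi (v / 4) = v / 2 + takagi v / 4.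
Proof.
by move=> /(takagi_scale 2); rewrite mulrC (_ : 2 ^- 2 = 4^-1 :> R) ?expr2; lra.
Qed.

(** On [[1/4, 1/2]] the first two terms of the series have slopes [1] and [-1] and add up to
    [1/2]. *)
Lemma takagi_right_quarter v : 0 <= v <= 1 ->
  takagi (1 / 4 + v / 4) = 1 / 2 + takagi v / 4.
Proof.
move=> hv; rewrite takagi_half; last lra.
rewrite -takagi_sym (_ : 1 - _ = (1 - v) / 2); last lra.
rewrite takagi_half; last lra.
by rewrite (_ : 2 * _ = 1 - v) ?takagi_sym; lra.
Qed.

(** At a maximum point, the two quarter formulas bound the maximum [M] by [1/2 + M/4]. *)
Lemma takagi_le23 x : 0 <= x <= 1 -> takagi x <= 2 / 3.
Proof.
move=> hx.
have [|c hc cmax] := @EVT_max R takagi 0 1 ler01.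
  exact: continuous_subspaceT (@continuous_takagi R).
have {}cmax z : 0 <= z <= 1 -> takagi z <= takagi c.
  by move=> hz; apply: cmax; rewrite in_itv.
suff : takagi c <= 2 / 3 by apply: le_trans; exact: cmax.
have hlf z : 0 <= z <= 1 / 2 -> takagi z <= 1 / 2 + takagi c / 4.
  move=> hz; have [z4|z4] := leP z (1 / 4).
    have := @takagi_left_quarter (4 * z); have := cmax (4 * z).
    by rewrite (_ : 4 * z / 4 = z); lra.
  have := @takagi_right_quarter (4 * z - 1); have := cmax (4 * z - 1).
  by rewrite (_ : 1 / 4 + _ / 4 = z); lra.
have := hlf c; have := hlf (1 - c).
by rewrite takagi_sym; move: hc; rewrite in_itv /=; case: (leP c (1 / 2)); lra.
Qed.

(* For [1/2 < w] and [0 < c], one has [T w = 1 - w + T (2 w - 1) / 2], and the bound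
   with slope [c - 1] at [2 w - 1] is more than enough. *)
Lemma takagi_le_line c w : 0 <= w <= 1 ->
  takagi w <= c%:R * w + 2 ^- c * (2 / 3).
Proof.
elim: c w => [|c IH] w hw.
  by rewrite mul0r add0r expr0 invr1 mul1r; exact: takagi_le23.
have c0 : 0 <= c%:R :> R by exact: ler0n.
have [w2|w2] := leP w (1 / 2).
  rewrite takagi_half ?pow2VS -?(natr1 _ c); last lra.
  by have := IH (2 * w); lra.
rewrite -takagi_sym takagi_half ?pow2VS -?(natr1 _ c); last lra.
rewrite -takagi_sym; have := IH (1 - 2 * (1 - w)).
by nra.
Qed.

(** The case [k = 2] is the right quarter. The functional equation reduces [x] to [2 * x] at the
    previous index; its extra [x / 4] is absorbed by [takagi x / 4]. *)
Lemma takagi_piece k x : (2 <= k)%N -> 0 <= x <= 2 ^- (k - 2) ->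
  takagi (2 ^- k + x / 4) = tk R k + takagi x / 4.
Proof.
case: k => [|[|k]]//; rewrite !subSS subn0 => _.
elim: k x => [|k IH] x; first rewrite expr0 invr1.
  move=> hx; rewrite (_ : 2 ^- 2 = 1 / 4) ?takagi_right_quarter ?tk2//.
  by rewrite expr2; lra.
have p0 := pow2V_gt0 k; have p1 := pow2V_le1 k.
have e1 := pow2VS k; have e2 := pow2VS k.+1; have e3 := pow2VS k.+2.
rewrite e1 => hx; rewrite takagi_half; last lra.
rewrite (_ : 2 * _ = 2 ^- k.+2 + (2 * x) / 4); last lra.
by rewrite IH ?tkS ?(@takagi_half _ x); lra.
Qed.

(** Values on [[1/4, 1/2]] are at least [1/2], the largest [tk]; smaller arguments are doubled. *)
Lemma takagi_ge_tk k x : (0 < k)%N -> 2 ^- k <= x <= 1 / 2 -> tk R k <= takagi x.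
Proof.
case: k => // k _; elim: k x => [|k IH] x hx.
  rewrite tk1; move: hx; rewrite expr1 => hx.
  have -> : x = 1 / 2 by lra.
  by rewrite takagi_half; [have := takagi_ge0 (2 * (1 / 2 : R)); lra|lra].
have [x4|x4] := leP x (1 / 4).
  rewrite tkS takagi_half; last by have := pow2V_gt0 k.+2; lra.
  have := IH (2 * x); move: hx; rewrite (pow2VS k.+1); lra.
apply: (@le_trans _ _ (tk R 1)); first exact: tk_anti.
rewrite tk1 (_ : x = 1 / 4 + (4 * x - 1) / 4); last lra.
rewrite takagi_right_quarter; last lra.
by have := takagi_ge0 (4 * x - 1); lra.
Qed.

(** With [x = 2 ^- k * u], applying [takagi_le_line] at [1 - u] cancels the linear term [k * u]. *)
Lemma takagi_le_tk k x : 0 <= x <= 2 ^- k ->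
  takagi x <= tk R k + 2 ^- k * 2 ^- k * (2 / 3).
Proof.
have p0 := pow2V_gt0 k => hx.
have kx : 2 ^- k * (2 ^+ k * x) = x by rewrite mulKf// expf_neq0// pnatr_eq0.
have hu : 0 <= 2 ^+ k * x <= 1.
  by rewrite -(ler_pM2l p0) -(@ler_pM2l _ _ p0 _ 1) kx mulr0 mulr1.
rewrite -kx takagi_scale// -takagi_sym.
rewrite (_ : tk R k + _ = 2 ^- k * (k%:R + 2 ^- k * (2 / 3))); last by rewrite tkE; lra.
by rewrite ler_pM2l//; have := takagi_le_line k (1 - 2 ^+ k * x); lra.
Qed.

(* The bump realizing equality in [takagi_le_tk], hanging to the left of [2^-k]. *)
Lemma takagi_left_bump k u : 0 <= u <= 1 ->
  takagi (2 ^- k * (1 - 2 ^- k * u)) = tk R k + 2 ^- k * 2 ^- k * takagi u.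
Proof.
have := pow2V_gt0 k; have := pow2V_le1 k => p1 p0 hu.
rewrite takagi_scale ?takagi_sym ?takagi_scale ?tkE; [|by []|by nra].
by lra.
Qed.

End SelfSimilarity.

(** * Reduction to solutions in [[0, 1/2)] *)

Section HalfLevelSet.
Context {R : realType}.
Implicit Types (x y : R) (k n : nat).

Definition half_level_set y : set R := [set x | 0 <= x < 1 / 2 /\ takagi x = y].

Lemma half_level_set_nonempty y : 0 <= y < 1 / 2 -> half_level_set y !=set0.
Proof.
move=> hy; have [|x hx xy] := @takagi_surj R y; first lra.
by exists x; split => //; lra.
Qed.

(** Reflection pairs the solutions below [1/2] with those above, and [1/2] is no solution, its value
    being [1/2]. *)
Lemma card_level_set2 y : 0 <= y < 1 / 2 ->
  (level_set y #= `I_2)%card <-> is_subset1 (half_level_set y).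
Proof.
move=> hy; split=> [/card_set_bijP[f [ff fi _]] a b [ha Ta] [hb Tb]|sub1].
  have La : level_set y a by split => //; lra.
  have Lb : level_set y b by split => //; lra.
  have Lc : level_set y (1 - a) by split; [lra|rewrite takagi_sym].
  have inj u v : level_set y u -> level_set y v -> f u = f v -> u = v.
    by move=> hu hv; apply: fi; rewrite inE.
  move: (ff _ La) (ff _ Lb) (ff _ Lc).
  move: (inj _ _ La Lb) (inj _ _ La Lc) (inj _ _ Lb Lc) => /=.
  (* Two of [a], [b], [1 - a] share a value of [f]; since [a] and [b] lie below [1/2] and [1 - a]
     above, only [a = b] is possible. *)
  case: (f a) => [|[|?]]// h1; case: (f b) h1 => [|[|?]]// h1;
    case: (f (1 - a)) => [|[|?]]// h2 h3 _ _ _; try exact: h1.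
  - by have := h2 erefl; lra.
  - by have := h3 erefl; lra.
  - by have := h3 erefl; lra.
  - by have := h2 erefl; lra.
have [a [ha Ta]] := half_level_set_nonempty _ hy.
have T2 : takagi (1 / 2 : R) = 1 / 2.
  have h := @takagi_half R (1 / 2); have := takagi_sym (0 : R).
  by rewrite takagi0 subr0; move: h; rewrite (_ : 2 * (1 / 2) = 1); lra.
have LE x : level_set y x -> x = a \/ x = 1 - a.
  move=> [hx Tx]; have [x2|x2|x2] := ltgtP x (1 / 2).
  - by left; apply: sub1 => //; split => //; lra.
  - right; suff : 1 - x = a by lra.
    by apply: sub1; split=> //; [lra|rewrite takagi_sym].
  - by move: Tx; rewrite x2; lra.
apply/card_set_bijP; exists (fun x => (x != a) : nat); split.
- by move=> x _ /=; case: (x != a).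
- move=> u v /set_mem/LE hu /set_mem/LE hv.
  have na : (1 - a == a) = false by apply/eqP; lra.
  by case: hu => ->; case: hv => ->; rewrite ?eqxx ?na.
- move=> [|[|]]//= _.
    by exists a; [split => //; lra|rewrite eqxx].
  exists (1 - a); first by split; [lra|rewrite takagi_sym].
  by have /eqP -> : 1 - a <> a by lra.
Qed.

(** * The index of [y] and the range of [Psi] *)

Lemma exists_tk_le y : 0 < y -> exists k, (2 <= k)%N && (tk R k <= y).
Proof.
move=> y0; pose n := (Num.Def.archi_bound (2 / y)).+1.
have hn : 2 / y < 2 ^+ n by apply: upper_nthrootP; rewrite /n.
(* The even index splits [2 ^- (n + n)] into two factors, one of which absorbs [n]. *)
exists (n + n)%N; rewrite addnS addSn /= -addSn -addnS -/n tkE exprD invfM.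
have := pow2V_gt0 (R := R) n; have n2 : n%:R * 2 ^- n <= 1 :> R.
  by rewrite ler_pdivrMr ?exprn_gt0// mul1r -natrX ler_nat ltnW// ltn_expl.
have : 2 * 2 ^- n <= y.
  by rewrite ler_pdivrMr ?exprn_gt0// mulrC -ler_pdivrMr// ltW.
by rewrite natrD; nra.
Qed.

Lemma Iindex_spec y : 0 < y < 1 / 2 ->
  (3 <= Iindex y)%N /\ tk R (Iindex y) <= y < tk R (Iindex y).-1.
Proof.
move=> /andP[y0 y2].
have : exists k, (2 <= k)%N /\ Iset k y.
  case: (ex_minnP (exists_tk_le _ y0)) => k /andP[k2 ky] kmin.
  (* The least [k >= 2] with [tk R k <= y] works; [k = 2] would give [1/2 <= y]. *)
  exists k; split => //; rewrite /Iset; case: eqP => [kE|kN].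
    by move: ky; rewrite kE tk2; lra.
  rewrite /= in_itv /= ky ltNge; apply/negP => ky'.
  have := kmin k.-1; rewrite ky' andbT.
  by move: k2 kN; case: k {ky kmin ky'} => [|[|[|k]]]//= _ _ /(_ isT); rewrite ltnn.
move=> /(xgetPex 0%N); rewrite -/(Iindex y) /Iset => -[].
case: eqP => [_ _|kN k2]; rewrite /= in_itv /=; first lra.
by move=> hk; split => //; rewrite ltn_neqAle eq_sym; apply/andP; split=> //; apply/eqP.
Qed.

Lemma PhiE y : 0 < y < 1 / 2 ->
  Phi y = 4 ^+ Iindex y * (y - tk R (Iindex y)).
Proof. by move=> hy; rewrite /Phi gt_eqF ?leNgt; [case: ifP; lra|lra]. Qed.

Lemma PsiE y : 0 < y < 1 / 2 -> Psi y = 4 * (y - tk R (Iindex y)).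
Proof. by move=> hy; rewrite /Psi gt_eqF; lra. Qed.

(** For [k] the index, [4 * (t_(k-1) - t_k) = t_(k-2)]. *)
Lemma Psi_bounds y : 0 < y < 1 / 2 ->
  0 <= Psi y < tk R (Iindex y - 2) /\ tk R (Iindex y - 2) <= 1 / 2.
Proof.
move=> hy; rewrite PsiE//; have [] := Iindex_spec y hy.
case: (Iindex y) => [|[|[|m]]]//= _ hm; rewrite !subSS subn0; split.
  have e2 := pow2VS (R := R) m.+2.
  by move: hm; rewrite (tkS m.+2) (tkS m.+1); lra.
by rewrite -[leRHS]tk1; exact: tk_anti.
Qed.

(** * Transfer of solutions between [y] and [Psi y] *)

Lemma half_level_set_lift y x : 0 < y < 1 / 2 -> half_level_set (Psi y) x ->
  half_level_set y (2 ^- Iindex y + x / 4) /\ 2 ^- Iindex y <= 2 ^- Iindex y + x / 4.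
Proof.
move=> hy [hx Tx]; have [hP _] := Psi_bounds y hy.
have [k3 _] := Iindex_spec y hy; have PE := PsiE y hy.
(* Further right, [takagi] is at least [tk R (Iindex y - 2)], which exceeds [Psi y]. *)
have xk : x <= 2 ^- (Iindex y - 2).
  rewrite leNgt; apply/negP => xk.
  by have := takagi_ge_tk (Iindex y - 2) x; rewrite subn_gt0 k3 Tx; lra.
split; last lra; split.
  have := pow2V_gt0 (R := R) (Iindex y); have := pow2V_anti (R := R) 3 (Iindex y) k3.
  by lra.
by rewrite takagi_piece ?(ltnW k3)//; lra.
Qed.

Lemma half_level_set_drop y x : 0 < y < 1 / 2 -> 2 / 3 < Phi y ->
  half_level_set y x ->
  exists2 x', half_level_set (Psi y) x' & x = 2 ^- Iindex y + x' / 4.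
Proof.
move=> hy; rewrite PhiE// => hP [hx Tx]; have PE := PsiE y hy.
have [k3 hk] := Iindex_spec y hy; move: (Iindex y) => k in k3 hk hP PE *.
have p0 := pow2V_gt0 (R := R) k.
have xk : 2 ^- k < x.
  rewrite ltNge; apply/negP => xk.
  have := takagi_le_tk k x; rewrite Tx -pow4VE.
  have p4 : 0 < 4 ^+ k :> R by rewrite exprn_gt0.
  have : 4 ^- k * (2 / 3) < y - tk R k by rewrite mulrC ltr_pdivrMr// [ltRHS]mulrC.
  by lra.
have xk1 : x < 2 ^- k.-1.
  rewrite ltNge; apply/negP => xk1.
  by have := takagi_ge_tk k.-1 x; rewrite Tx -ltnS prednK ?(ltnW k3) ?(leq_trans _ k3)//; lra.
have xE : x = 2 ^- k + 4 * (x - 2 ^- k) / 4 by lra.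
exists (4 * (x - 2 ^- k)) => //.
case: k k3 hk hP PE p0 xk xk1 xE => [|[|[|m]]]// _ hk hP PE p0 xk xk1 xE.
have e3 := pow2VS (R := R) m.+2; have e2 := pow2VS (R := R) m.+1.
have p1 : 2 ^- m.+1 <= 1 / 2 :> R by have := pow2V_anti (R := R) 1 m.+1 isT; rewrite expr1; lra.
rewrite /= in xk1; split; first lra.
have := takagi_piece m.+3 (4 * (x - 2 ^- m.+3)) isT.
by rewrite -xE !subSS subn0 Tx PE; lra.
Qed.

Lemma half_level_set_left y : 0 < y < 1 / 2 -> Phi y <= 2 / 3 ->
  exists2 x, half_level_set y x & x < 2 ^- Iindex y.
Proof.
move=> hy; rewrite PhiE//; have [k3 hk] := Iindex_spec y hy.
move: (Iindex y) => k in k3 hk *.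
set z := (X in X <= _) => hz.
have z0 : 0 <= z by rewrite mulr_ge0 ?exprn_ge0//; lra.
have [|u hu Tu] := @takagi_surj R z; first lra.
have p0 := pow2V_gt0 (R := R) k; have := pow2V_le1 (R := R) k.
have p8 := pow2V_anti (R := R) 1 k (ltnW (ltnW k3)); rewrite expr1 in p8 => p1.
(* The bump is used at [1 - u], which is positive since [u <= 1/3]; this makes the inequality
   strict. *)
exists (2 ^- k * (1 - 2 ^- k * (1 - u))); last by nra.
split; first by nra.
rewrite takagi_left_bump ?takagi_sym ?Tu; last lra.
by rewrite -pow4VE mulKf ?expf_neq0 ?pnatr_eq0//; lra.
Qed.

Lemma half_level_set_subset1_Psi y : 0 < y < 1 / 2 ->
  is_subset1 (half_level_set y) ->
  [/\ 2 / 3 < Phi y, 0 < Psi y < 1 / 2 & is_subset1 (half_level_set (Psi y))].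
Proof.
move=> hy sub1; have [hP tP] := Psi_bounds y hy.
have Pgt : 2 / 3 < Phi y.
  (* Otherwise a solution left of [2 ^- Iindex y] coexists with a lifted one, which is not left of
     it. *)
  rewrite ltNge; apply/negP => /half_level_set_left-/(_ hy)[a ha ak].
  have [|x hx] := half_level_set_nonempty (Psi y); first lra.
  have [hb bk] := half_level_set_lift _ _ hy hx.
  by have := sub1 _ _ ha hb; lra.
split=> // [|a b ha hb].
  have : 0 < Psi y; last lra.
  rewrite lt_neqAle; case/andP: hP => -> _; rewrite andbT eq_sym.
  apply/eqP => P0; move: Pgt; rewrite PhiE//.
  have -> : y - tk R (Iindex y) = 0 by move: P0; rewrite PsiE//; lra.
  by rewrite mulr0; lra.
have [ha' _] := half_level_set_lift _ _ hy ha.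
have [hb' _] := half_level_set_lift _ _ hy hb.
by have := sub1 _ _ ha' hb'; lra.
Qed.

Lemma half_level_set_contract n y a b : 0 < y < 1 / 2 ->
  (forall m, 2 / 3 < Phi (iter m Psi y)) ->
  half_level_set y a -> half_level_set y b -> `|a - b| <= 4 ^- n.
Proof.
elim: n y a b => [|n IH] y a b hy hP ha hb.
  by case: ha hb => ha _ [hb _]; rewrite expr0 invr1 ler_norml; lra.
have hP0 := hP 0%N; rewrite /= in hP0.
have [a' ha' ->] := half_level_set_drop _ _ hy hP0 ha.
have [b' hb' ->] := half_level_set_drop _ _ hy hP0 hb.
(* Positivity of [Phi y] excludes [y = tk R (Iindex y)], so the orbit never reaches [0]. *)
have hy' : 0 < Psi y < 1 / 2.
  have [h1 h2] := Psi_bounds y hy; have := hP0; rewrite PhiE// => h3.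
  rewrite PsiE// in h1 *; have : 0 < y - tk R (Iindex y); last lra.
  by rewrite -(pmulr_rgt0 _ (exprn_gt0 (Iindex y) (ltr0n R 4))); lra.
have := IH _ _ _ hy' _ ha' hb'.
have /[swap] /[apply] : forall m, 2 / 3 < Phi (iter m Psi (Psi y)).
  by move=> m; have := hP m.+1; rewrite iterSr.
by rewrite exprSr invfM mulrC !ler_norml; lra.
Qed.

End HalfLevelSet.

Theorem theorem4p1 (R : realType) (y : R) (hy0 : 0 < y) (hy1 : y < 1 / 2) :
  (level_set y #= `I_2)%card <->
  (forall n : nat, Phi (iter n Psi y) > 2 / 3).
Proof.
rewrite card_level_set2; last lra.
have hy : 0 < y < 1 / 2 by rewrite hy0.
split=> [sub1 n|hP a b ha hb].
  elim: n y hy {hy0 hy1} sub1 => [|n IH] z hz /(half_level_set_subset1_Psi _ hz)[] //.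
  by rewrite iterSr => _; exact: IH.
(* Equality follows once the distance is below every [e > 0], by [4 ^- n <= 2 ^- n < e] for large
   [n]. *)
apply/eqP; rewrite -subr_eq0 -normr_le0; apply/ler_addgt0Pl => e e0; rewrite addr0.
have [n hn] : exists n, e^-1 < 2 ^+ n.
  by exists (Num.Def.archi_bound e^-1); apply: upper_nthrootP.
apply: le_trans (half_level_set_contract n y a b hy hP ha hb) _.
rewrite -[leRHS]invrK lef_pV2 ?posrE ?exprn_gt0 ?invr_gt0//.
by rewrite (le_trans (ltW hn))// lerXn2r ?nnegrE//; lra.
Qed.
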